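(* Let $\Bbbk^\bullet$ be a set of forcing commands closed under anti-$\to_\bullet$-evaluation. For every MAL formula $C$, every positive propositional domain $\mathcal D^{\oplus\bullet}$ (for the countdown interpretation, containing all sets $\|\mathcal C[p]\|^\bullet$), every total valuation $\rho^\bullet$, every closed term $t$ and every $p\in\mathbb N$, $$t\in\|C^*(\mathbf p)\|^\bullet_{\rho^\bullet}\iff(t,p)\in\|C\|^\circ_{\rho^\circ}.$$ Here $\|C^*(\mathbf p)\|^\bullet_{\rho^\bullet}$ is the countdown-machine realizability interpretation of the forcing translation $C^*$ at the numeral $\mathbf p$, and $\|C\|^\circ_{\rho^\circ}$ is the quantitative realizability interpretation of $C$ over the monoid $\mathbb N$ with pole $\Bbbk^\circ$ and valuation $\rho^\circ$ induced by $\Bbbk^\bullet$ and $\rho^\bullet$.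
   Context: **Terms.** Positive variables $x,\dots$, negative variables $\alpha,\dots$, $\kappa,\kappa'$ of either polarity. Positive values $V_+::=x\mid (V,V')\mid\{V\}\mid\overline n\ (n\in\mathbb N)\mid k_+$ (other constants); values $V::=V_+\mid t_-$; positive terms $t_+::=V_+\mid\mu\alpha.c$; negative terms $t_-::=\alpha\mid\mu(\kappa,\kappa').c\ (\kappa\neq\kappa')\mid\mu\{\kappa\}.c\mid\mu x.c\mid k_-$; commands $c::=\langle t_+|t_-\rangle$ with $\langle t|u\rangle$ and $\langle u|t\rangle$ identified. Pairs/one-tuples $(t,u)$, $\{t\}$ of non-values, should they occur, are abbreviations for $\mu\alpha.\langle t|\mu\kappa.\langle u|\mu\kappa'.\langle(\kappa,\kappa')|\alpha\rangle\rangle\rangle$, $\mu\alpha.\langle t|\mu\kappa.\langle\{\kappa\}|\alpha\rangle\rangle$. **Countdown machine.** A negative command is $\langle t^\ominus|u_+\rangle$ with $t$ a term of either polarity and $u_+$ a positive term ($\ominus$ is just a mark). A forcing command is a negative command $\langle t^\ominus|(u,K)\rangle$, also written $\langle t^\ominus|u\rangle\{K\}$, where $K$ is a term and $t,u$ are terms of opposite polarities; $\langle t^\ominus|u\rangle\{K\}$ and $\langle u^\ominus|t\rangle\{K\}$ are identified. For a command $c=\langle t_+|u_-\rangle$, $c^\bullet\{K\}=\langle u_-^\ominus|(t_+,K)\rangle$. Reduction $\to_\bullet$: $\langle t_-^\ominus|\mu\alpha.c\rangle\{\overline n\}\to_\bullet(c[t_-/\alpha])^\bullet\{\overline n\}$;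 $\langle(\mu x.c)^\ominus|V_+\rangle\{\overline n\}\to_\bullet(c[V_+/x])^\bullet\{\overline n\}$; $\langle(\mu(\kappa,\kappa').c)^\ominus|(V_1,V_2)\rangle\{\overline{n+1}\}\to_\bullet(c[V_1/\kappa,V_2/\kappa'])^\bullet\{\overline n\}$; $\langle(\mu\{\kappa\}.c)^\ominus|\{V\}\rangle\{\overline{n+1}\}\to_\bullet(c[V/\kappa])^\bullet\{\overline n\}$; the last two redexes with counter $\overline0$ diverge. Closed under anti-evaluation: $c\to_\bullet c'$ and $c'\in\Bbbk^\bullet$ imply $c\in\Bbbk^\bullet$. **Countdown interpretation.** Let $\Bbbk^\bullet_0=\{\langle t_+|u_-\rangle:\langle u_-^\ominus|t_+\rangle\in\Bbbk^\bullet\}$. Closed terms $t_+$ (positive) and $u_-$ (negative) are orthogonal if $\langle t_+|u_-\rangle\in\Bbbk^\bullet_0$; for a set $X$ of closed terms of one polarity, $X^\bot$ is the set of closed terms of the other polarity orthogonal to all elements of $X$. $X\otimes Y=\{(t,u):t\in X,u\in Y\}$, $\downarrow X=\{\{t\}:t\in X\}$. A positive propositional domain $\mathcal D^{\oplus\bullet}$ is a set of sets of closed positive values, closed under unions and intersections of families and such that $X\otimes Y,\downarrow X\in\mathcal D^{\oplus\bullet}$ for all $X,Y\in\mathcal D^{\oplus\bullet}\cup\{Z^\bot:Z\in\mathcal D^{\oplus\bullet}\}$; it is assumed to contain each set $\|\mathcal C[p]\|^\bullet=\{\overline n:n\in\mathbb N,\ p\le n\}$, $p\in\mathbb N$, which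 interprets a positive predicate constant $\mathcal C[\cdot]:\iota\to o^+$ ($\iota$ is the kind of natural numbers, $o^\pm$ the kinds of positive/negative formulas). A total valuation $\rho^\bullet$ assigns in particular to each variable $X^{\iota\to o^+}$ a function $\mathbb N\to\mathcal D^{\oplus\bullet}$. Formulas are interpreted by: $\|A\otimes B\|^\bullet=\|A\|^\bullet\otimes\|B\|^\bullet$; $\|\downarrow A\|^\bullet=\downarrow\|A\|^\bullet$; $\|\exists r.A\|^\bullet=\bigcup_{r\in\mathbb N}\|A\|^\bullet$ for $A$ positive. The equational implication $\langle T=U\rangle A$ (informally ''$T\cong U$ implies $A$'', of the same polarity as $A$) is interpreted as $A$ is if $T\cong U$ (i.e. $T$ and $U$ are convertible: they denote the same number), and by $\emptyset^\bot$ (all closed terms of the polarity of $A$) otherwise. A negative formula $N$ (built with $\wp,\uparrow,\forall$) is interpreted by orthogonality: $t\in\|N\|^\bullet$ iff $\langle t^\ominus|u\rangle\in\Bbbk^\bullet$ for every $u\in\|N^\bot\|^\bullet$, where $t$ is a closed term that need not be negative. **MAL and forcing translation.** MAL formulas: $A,B::=P\mid N$; $P::=X\mid A\otimes B\mid\downarrow A$; $N::=X^\bot\mid A\wp B\mid\uparrow A$, with the usual De Morgan involutive negation ($\otimes/\wp$, $\downarrow/\uparrow$, $X/X^\bot$). For a predicate $Z$ on $\iota$, its forcing orthogonal is $\overline Z=\lambda r.\forall r'.\,Z(r')\multimap\mathcal C[r+r']^\bot$, with $A\multimap B=A^\bot\wp B$; thus $\|\overline Z(\mathbf p)\|^\bullet$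 is the set of closed $t$ such that $\langle t^\ominus|(u,K)\rangle\in\Bbbk^\bullet$ for all $r\in\mathbb N$, $u\in\|Z(\mathbf r)\|^\bullet$, $K\in\|\mathcal C[p+r]\|^\bullet$. The translation: $X^*=X^{\iota\to o^+}$; $(X^\bot)^*=\overline{X^{\iota\to o^+}}$; $(A\otimes B)^*=\lambda r.\exists p_1.\exists p_2.\langle r=p_1+p_2\rangle(A^*(p_1)\otimes B^*(p_2))$; $(A\wp B)^*=\overline{\lambda r.\exists p_1.\exists p_2.\langle r=p_1+p_2\rangle((A^\bot)^*(p_1)\otimes(B^\bot)^*(p_2))}$; $(\downarrow A)^*=\lambda r.\downarrow A^*(r)$; $(\uparrow A)^*=\overline{\lambda r.\downarrow(A^\bot)^*(r)}$. $\mathbf p$ is the numeral of $p$. **Induced quantitative interpretation.** $\Bbbk^\circ=\{(c,p):c\text{ closed command},\ p\in\mathbb N,\ \forall K\in\|\mathcal C[p]\|^\bullet,\ c^\bullet\{K\}\in\Bbbk^\bullet\}$; $\rho^\circ(X)=\{(t,p):t\in\rho^\bullet(X^{\iota\to o^+})(p)\}$. A closed positive weighted term $(t_+,p)$ and a closed negative weighted term $(t_-,q)$ ($p,q\in\mathbb N$) are orthogonal if $(\langle t_+|t_-\rangle,p+q)\in\Bbbk^\circ$; for a set $X$ of positive (resp. negative) weighted terms, $X^\bot$ is the set of negative (resp. positive) weighted terms orthogonal to every element of $X$. $\|X\|^\circ=\rho^\circ(X)$; $\|X^\bot\|^\circ=\rho^\circ(X)^\bot$; $\|A\otimes B\|^\circ=\{((t,u),p+q):(t,p)\in\|A\|^\circ,(u,q)\in\|B\|^\circ\}$;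 $\|\downarrow A\|^\circ=\{(\{t\},p):(t,p)\in\|A\|^\circ\}$; $\|A\wp B\|^\circ=(\|A^\bot\otimes B^\bot\|^\circ)^\bot$; $\|\uparrow A\|^\circ=(\|\downarrow A^\bot\|^\circ)^\bot$ (all with valuation $\rho^\circ$).
   Formalization: A failing ⟨T=U⟩A with A positive is interpreted by ∅ (not by all closed positive terms), and elements t of a negative ‖N‖ must have the polarity making ⟨t^⊖|u⟩ a forcing command, so elements of a forcing orthogonal of a positive predicate are negative even when the predicate is empty. *)

(* Defs.v *)
From mathcomp Require Import all_boot boolp classical_sets.

Set Implicit Arguments.
Unset Strict Implicit.
Unset Printing Implicit Defensive.

Local Open Scope classical_set_scope.

Inductive pol := Pos | Neg.

Definition opp (e : pol) : pol := if e is Pos then Neg else Pos.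

Definition same_pol (e e' : pol) : bool :=
  match e, e' with Pos, Pos | Neg, Neg => true | _, _ => false end.

(** * Terms

    Variables are de Bruijn indices, with one independent index space per
    polarity: a binder of polarity [e] shifts the indices of polarity [e] only.
    [K e] is the type of the additional constants of polarity [e].  Every
    negative term is a value, so [value Neg] is the type of negative terms. *)

Inductive value (K : pol -> Type) : pol -> Type :=
| Var e (i : nat) : value K e
| Pair e e' (V : value K e) (V' : value K e') : value K Pos
| Box e (V : value K e) : value K Pos
| Num (n : nat) : value K Pos
| Cst e (k : K e) : value K e
  (* mu(kappa,kappa').c with kappa, kappa' of polarities e, e'; the variable
     kappa' is the innermost one *)
| MuPair (e e' : pol) (c : cmd K) : value K Neg
| MuBox (e : pol) (c : cmd K) : value K Neg
| MuPos (c : cmd K) : value K Neg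
with pterm (K : pol -> Type) : Type :=
| Val (V : value K Pos)
| Mu (c : cmd K)
with cmd (K : pol -> Type) : Type :=
| Cut (t : pterm K) (u : value K Neg).

Arguments Var {K} e i.
Arguments Num {K} n.

Inductive term (K : pol -> Type) : Type :=
| TPos (t : pterm K)
| TNeg (u : value K Neg).

Definition numeral (K : pol -> Type) (n : nat) : term K := TPos (Val (Num n)).
Arguments numeral {K} n.

Definition tpol (K : pol -> Type) (t : term K) : pol :=
  if t is TPos _ then Pos else Neg.

(** ** Closed terms *)

Definition bump (e : pol) (b : pol -> nat) : pol -> nat :=
  fun e' => b e' + same_pol e e'.

(* The free variables of polarity [e] are among the first [b e] ones. *)
Fixpoint scoped_value K (b : pol -> nat) e (V : value K e) : bool :=
  match V with
  | Var e i => i < b e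
  | Pair _ _ V V' => scoped_value b V && scoped_value b V'
  | Box _ V => scoped_value b V
  | Num _ => true
  | Cst _ _ => true
  | MuPair e e' c => scoped_cmd (bump e' (bump e b)) c
  | MuBox e c => scoped_cmd (bump e b) c
  | MuPos c => scoped_cmd (bump Pos b) c
  end
with scoped_pterm K (b : pol -> nat) (t : pterm K) : bool :=
  match t with
  | Val V => scoped_value b V
  | Mu c => scoped_cmd (bump Neg b) c
  end
with scoped_cmd K (b : pol -> nat) (c : cmd K) : bool :=
  match c with Cut t u => scoped_pterm b t && scoped_value b u end.

Definition closed_cmd K (c : cmd K) : bool := scoped_cmd (fun=> 0) c.

Definition closed_term K (t : term K) : bool :=
  match t with
  | TPos t => scoped_pterm (fun=> 0) t
  | TNeg u => scoped_value (fun=> 0) u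
  end.

(** ** Renaming and substitution *)

Definition renaming := pol -> nat -> nat.

Definition shift (e : pol) : renaming :=
  fun e' i => if same_pol e e' then i.+1 else i.

Definition up_ren (e : pol) (xi : renaming) : renaming :=
  fun e' i =>
    if same_pol e e' then if i is j.+1 then (xi e' j).+1 else 0 else xi e' i.

Fixpoint ren_value K (xi : renaming) e (V : value K e) : value K e :=
  match V in value _ e return value K e with
  | Var e i => Var e (xi e i)
  | Pair _ _ V V' => Pair (ren_value xi V) (ren_value xi V')
  | Box _ V => Box (ren_value xi V)
  | Num n => Num n
  | Cst _ k => Cst k
  | MuPair e e' c => MuPair e e' (ren_cmd (up_ren e' (up_ren e xi)) c)
  | MuBox e c => MuBox e (ren_cmd (up_ren e xi) c)
  | MuPos c => MuPos (ren_cmd (up_ren Pos xi) c)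
  end
with ren_pterm K (xi : renaming) (t : pterm K) : pterm K :=
  match t with
  | Val V => Val (ren_value xi V)
  | Mu c => Mu (ren_cmd (up_ren Neg xi) c)
  end
with ren_cmd K (xi : renaming) (c : cmd K) : cmd K :=
  match c with Cut t u => Cut (ren_pterm xi t) (ren_value xi u) end.

Definition ren_term K (xi : renaming) (t : term K) : term K :=
  match t with
  | TPos t => TPos (ren_pterm xi t)
  | TNeg u => TNeg (ren_value xi u)
  end.

Definition substitution K := forall e, nat -> value K e.

Definition scons K (e : pol) :
    value K e -> substitution K -> substitution K :=
  match e with
  | Pos => fun V s e' =>
      match e' with
      | Pos => fun i => if i is j.+1 then s Pos j else V
      | Neg => s Neg
      end
  | Neg => fun V s e' =>
      match e' with
      | Pos => s Pos
      | Neg => fun i => if i is j.+1 then s Neg j else V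
      end
  end.

Definition up_subst K (e : pol) (s : substitution K) : substitution K :=
  scons (Var e 0) (fun e' i => ren_value (shift e) (s e' i)).

Fixpoint subst_value K (s : substitution K) e (V : value K e) : value K e :=
  match V in value _ e return value K e with
  | Var e i => s e i
  | Pair _ _ V V' => Pair (subst_value s V) (subst_value s V')
  | Box _ V => Box (subst_value s V)
  | Num n => Num n
  | Cst _ k => Cst k
  | MuPair e e' c => MuPair e e' (subst_cmd (up_subst e' (up_subst e s)) c)
  | MuBox e c => MuBox e (subst_cmd (up_subst e s) c)
  | MuPos c => MuPos (subst_cmd (up_subst Pos s) c)
  end
with subst_pterm K (s : substitution K) (t : pterm K) : pterm K :=
  match t with
  | Val V => Val (subst_value s V)
  | Mu c => Mu (subst_cmd (up_subst Neg s) c)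
  end
with subst_cmd K (s : substitution K) (c : cmd K) : cmd K :=
  match c with Cut t u => Cut (subst_pterm s t) (subst_value s u) end.

Definition subst1 K e (V : value K e) (c : cmd K) : cmd K :=
  subst_cmd (scons V (@Var K)) c.

(* c[V/kappa, V'/kappa'], with kappa' the innermost variable *)
Definition subst2 K e e' (V : value K e) (V' : value K e') (c : cmd K) : cmd K :=
  subst_cmd (scons V' (scons V (@Var K))) c.

(** ** Tuples of arbitrary terms *)

(* <t|mu kappa.c>, with kappa of the polarity of t *)
Definition cut_mu K (t : term K) (c : cmd K) : cmd K :=
  match t with
  | TPos t => Cut t (MuPos c)
  | TNeg u => Cut (Mu c) u
  end.

(* When a component is not a value,
   mu alpha.<t|mu kappa.<u|mu kappa'.<(kappa,kappa')|alpha>>> *)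
Definition mkpair K (t u : term K) : pterm K :=
  match t, u with
  | TPos (Val V), TPos (Val V') => Val (Pair V V')
  | TPos (Val V), TNeg V' => Val (Pair V V')
  | TNeg V, TPos (Val V') => Val (Pair V V')
  | TNeg V, TNeg V' => Val (Pair V V')
  | _, _ =>
      let e := tpol t in
      let e' := tpol u in
      Mu (cut_mu (ren_term (shift Neg) t)
           (cut_mu (ren_term (shift e) (ren_term (shift Neg) u))
              (Cut (Val (Pair (Var e (same_pol e e')) (Var e' 0)))
                   (Var Neg (same_pol e Neg + same_pol e' Neg)))))
  end.

Definition mkbox K (t : term K) : pterm K :=
  match t with
  | TPos (Val V) => Val (Box V)
  | TNeg V => Val (Box V)
  | TPos (Mu _) =>
      Mu (cut_mu (ren_term (shift Neg) t)
            (Cut (Val (Box (Var Pos 0))) (Var Neg 0)))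
  end.

Definition tensor_set K (X Y : set (term K)) : set (term K) :=
  [set TPos (mkpair t u) | t in X & u in Y].

Definition down_set K (X : set (term K)) : set (term K) :=
  [set TPos (mkbox t) | t in X].

(** * The countdown machine *)

Inductive ncmd (K : pol -> Type) : Type :=
| NCut (t : term K) (u : pterm K).

(* <t^-|u>{k} *)
Definition fcmd K (t u k : term K) : ncmd K := NCut t (mkpair u k).

Definition is_forcing K (c : ncmd K) : Prop :=
  exists t u k : term K, tpol t = opp (tpol u) /\ c = fcmd t u k.

Definition bullet K (c : cmd K) (k : term K) : ncmd K :=
  match c with Cut t u => fcmd (TNeg u) (TPos t) k end.

Inductive red K : ncmd K -> ncmd K -> Prop :=
| red_mu (t : value K Neg) (c : cmd K) (n : nat) :
    red (fcmd (TNeg t) (TPos (Mu c)) (numeral n))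
        (bullet (subst1 t c) (numeral n))
| red_mu_pos (c : cmd K) (V : value K Pos) (n : nat) :
    red (fcmd (TNeg (MuPos c)) (TPos (Val V)) (numeral n))
        (bullet (subst1 V c) (numeral n))
| red_pair e e' (c : cmd K) (V : value K e) (V' : value K e') (n : nat) :
    red (fcmd (TNeg (MuPair e e' c)) (TPos (Val (Pair V V'))) (numeral n.+1))
        (bullet (subst2 V V' c) (numeral n))
| red_box e (c : cmd K) (V : value K e) (n : nat) :
    red (fcmd (TNeg (MuBox e c)) (TPos (Val (Box V))) (numeral n.+1))
        (bullet (subst1 V c) (numeral n)).

(* The identification of <t|u>{k} and <u|t>{k} is rendered by the invariance of
   the pole under [pole_sym]. *)
Record is_pole K (k : set (ncmd K)) : Prop := {
  pole_forcing : forall c, k c -> is_forcing c;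
  pole_sym : forall t u s : term K,
    tpol t = opp (tpol u) -> k (fcmd t u s) -> k (fcmd u t s);
  pole_anti : forall c c', red c c' -> k c' -> k c }.

(** * The countdown interpretation *)

Definition pole0 K (k : set (ncmd K)) : set (cmd K) :=
  [set c | match c with Cut t u => k (NCut (TNeg u) t) end].

Definition orthogonal K (k0 : set (cmd K)) (t u : term K) : Prop :=
  match t, u with
  | TPos a, TNeg b | TNeg b, TPos a => k0 (Cut a b)
  | _, _ => False
  end.

(* The orthogonal of a set [X] of terms of polarity [e]. *)
Definition orth K (k : set (ncmd K)) (e : pol) (X : set (term K)) :
    set (term K) :=
  [set u | [/\ closed_term u, tpol u = opp e &
            forall t, X t -> orthogonal (pole0 k) t u]].

Definition cst_set K (p : nat) : set (term K) :=
  [set numeral n | n in [set n | p <= n]].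

Definition closed_pos_values K : set (term K) :=
  [set t | closed_term t /\ exists V, t = TPos (Val V)].

(* The intersection of the empty family is not required to be in [D]. *)
Record is_domain K (k : set (ncmd K)) (D : set (set (term K))) : Prop := {
  domain_values : forall X, D X -> X `<=` @closed_pos_values K;
  domain_bigcup : forall F : set (set (term K)),
    F `<=` D -> D (\bigcup_(X in F) X);
  domain_bigcap : forall F : set (set (term K)),
    F !=set0 -> F `<=` D -> D (\bigcap_(X in F) X);
  domain_tensor : forall X Y,
    (D `|` orth k Pos @` D) X -> (D `|` orth k Pos @` D) Y ->
    D (tensor_set X Y);
  domain_down : forall X, (D `|` orth k Pos @` D) X -> D (down_set X);
  domain_cst : forall p, D (cst_set p) }.

(** ** Formulas with predicates on natural numbers *)

(* Terms of kind iota; variables are de Bruijn indices. *)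
Inductive iterm := IVar (i : nat) | INum (n : nat) | IAdd (T U : iterm).

Fixpoint ilift (T : iterm) : iterm :=
  match T with
  | IVar i => IVar i.+1
  | INum n => INum n
  | IAdd T U => IAdd (ilift T) (ilift U)
  end.

(* Up to De Morgan duality a negative formula is the dual of a unique positive
   one, and it is represented by that positive formula. *)
Inductive pform :=
| FVar (X : nat) (T : iterm)
| FCst (T : iterm)
| FTensor (A B : form)
| FDown (A : form)
| FEx (P : pform)
| FEq (T U : iterm) (P : pform)
with nform := FPerp (P : pform)
with form := FPos (P : pform) | FNeg (N : nform).

Definition fdual (A : form) : form :=
  match A with FPos P => FNeg (FPerp P) | FNeg (FPerp P) => FPos P end.

Definition fpar (A B : form) : nform := FPerp (FTensor (fdual A) (fdual B)).

Definition flolli (A B : form) : nform := fpar (fdual A) B.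

Definition fall (N : nform) : nform := match N with FPerp P => FPerp (FEx P) end.

Definition fpol (A : form) : pol := if A is FPos _ then Pos else Neg.

Record valuation K := Valuation {
  ival : nat -> nat;
  pval : nat -> nat -> set (term K) }.

Definition total_valuation K (D : set (set (term K))) (rho : valuation K) : Prop :=
  forall X n, D (pval rho X n).

Definition vcons K (r : nat) (rho : valuation K) : valuation K :=
  Valuation (fun i => if i is j.+1 then ival rho j else r) (pval rho).

Fixpoint ieval (v : nat -> nat) (T : iterm) : nat :=
  match T with
  | IVar i => v i
  | INum n => n
  | IAdd T U => ieval v T + ieval v U
  end.

(* If [u] is in the interpretation of a tensor A (x) B, possibly under
   existential and equational quantifiers, then <t^-|u> is a forcing command
   only if [t] and [A] have opposite polarities. *)
Fixpoint fits K (P : pform) (t : term K) : Prop :=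
  match P with
  | FTensor A _ => tpol t = opp (fpol A)
  | FEx P => fits P t
  | FEq _ _ P => fits P t
  | FVar _ _ | FCst _ | FDown _ => True
  end.

(* When T = U fails, the positive formula <T = U>P is interpreted by the empty
   set, so that its dual, the negative formula <T = U>(dual of P), is
   interpreted by the orthogonal of the empty set.
   The condition [fits] matters only when the interpretation of [P] is empty:
   the elements of the orthogonal are still those terms [t] for which the
   commands <t^-|u> are of the shape of forcing commands. *)
Fixpoint pinterp K (k : set (ncmd K)) (rho : valuation K) (P : pform) :
    set (term K) :=
  match P with
  | FVar X T => pval rho X (ieval (ival rho) T)
  | FCst T => cst_set (ieval (ival rho) T)
  | FTensor A B => tensor_set (interp k rho A) (interp k rho B)
  | FDown A => down_set (interp k rho A)
  | FEx P => \bigcup_(r in [set: nat]) pinterp k (vcons r rho) P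
  | FEq T U P =>
      if ieval (ival rho) T == ieval (ival rho) U then pinterp k rho P else set0
  end
with ninterp K (k : set (ncmd K)) (rho : valuation K) (N : nform) :
    set (term K) :=
  match N with
  | FPerp P =>
      [set t | [/\ closed_term t, fits P t &
                forall u, pinterp k rho P (TPos u) -> k (NCut t u)]]
  end
with interp K (k : set (ncmd K)) (rho : valuation K) (A : form) :
    set (term K) :=
  match A with
  | FPos P => pinterp k rho P
  | FNeg N => ninterp k rho N
  end.

(** * MAL and its forcing translation *)

Inductive mal :=
| MVar (X : nat)
| MTensor (A B : mal)
| MDown (A : mal)
| MCoVar (X : nat)
| MPar (A B : mal)
| MUp (A : mal).

Fixpoint mdual (A : mal) : mal :=
  match A with
  | MVar X => MCoVar X
  | MTensor A B => MPar (mdual A) (mdual B)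
  | MDown A => MUp (mdual A)
  | MCoVar X => MVar X
  | MPar A B => MTensor (mdual A) (mdual B)
  | MUp A => MDown (mdual A)
  end.

(* A predicate on iota is given by its application to terms of kind iota. *)

Definition forcing_orth (Z : iterm -> pform) (T : iterm) : form :=
  FNeg (fall (flolli (FPos (Z (IVar 0)))
                     (fdual (FPos (FCst (IAdd (ilift T) (IVar 0))))))).

Definition star_tensor (A B : iterm -> form) (T : iterm) : pform :=
  FEx (FEx (FEq (ilift (ilift T)) (IAdd (IVar 1) (IVar 0))
                (FTensor (A (IVar 1)) (B (IVar 0))))).

Definition star_down (A : iterm -> form) (T : iterm) : pform := FDown (A T).

(* [costar A] is the translation of [mdual A], see [costarE]. *)
Fixpoint star (A : mal) : iterm -> form :=
  match A with
  | MVar X => fun T => FPos (FVar X T)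
  | MTensor A B => fun T => FPos (star_tensor (star A) (star B) T)
  | MDown A => fun T => FPos (star_down (star A) T)
  | MCoVar X => forcing_orth (FVar X)
  | MPar A B => forcing_orth (star_tensor (costar A) (costar B))
  | MUp A => forcing_orth (star_down (costar A))
  end
with costar (A : mal) : iterm -> form :=
  match A with
  | MVar X => forcing_orth (FVar X)
  | MTensor A B => forcing_orth (star_tensor (star A) (star B))
  | MDown A => forcing_orth (star_down (star A))
  | MCoVar X => fun T => FPos (FVar X T)
  | MPar A B => fun T => FPos (star_tensor (costar A) (costar B) T)
  | MUp A => fun T => FPos (star_down (costar A) T)
  end.

Lemma mdualK : involutive mdual.
Proof. by elim=> //= [A -> B ->|A ->|A -> B ->|A ->]. Qed.

Lemma costarE (A : mal) : costar A = star (mdual A).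
Proof.
suff [] : costar A = star (mdual A) /\ star A = costar (mdual A) by [].
by elim: A => //= [A [hA gA] B [hB gB]|A [hA gA]|A [hA gA] B [hB gB]|A [hA gA]];
  rewrite ?hA ?gA ?hB ?gB.
Qed.

Lemma star_par (A B : mal) :
  star (MPar A B) = forcing_orth (star_tensor (star (mdual A)) (star (mdual B))).
Proof. by rewrite /= !costarE. Qed.

Lemma star_up (A : mal) :
  star (MUp A) = forcing_orth (star_down (star (mdual A))).
Proof. by rewrite /= !costarE. Qed.

(** * The induced quantitative interpretation *)

Definition pole_circ K (k : set (ncmd K)) : set (cmd K * nat) :=
  [set cp | closed_cmd cp.1 /\ forall s, cst_set cp.2 s -> k (bullet cp.1 s)].

Definition rho_circ K (rho : valuation K) (X : nat) : set (term K * nat) :=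
  [set tp | pval rho X tp.2 tp.1].

Definition worthogonal K (k : set (cmd K * nat)) (tp uq : term K * nat) : Prop :=
  match tp.1, uq.1 with
  | TPos a, TNeg b | TNeg b, TPos a => k (Cut a b, tp.2 + uq.2)
  | _, _ => False
  end.

(* The orthogonal of a set [X] of weighted terms of polarity [e]. *)
Definition worth K (k : set (cmd K * nat)) (e : pol) (X : set (term K * nat)) :
    set (term K * nat) :=
  [set uq | [/\ closed_term uq.1, tpol uq.1 = opp e &
             forall tp, X tp -> worthogonal k tp uq]].

Definition wtensor K (X Y : set (term K * nat)) : set (term K * nat) :=
  [set (TPos (mkpair tp.1 uq.1), tp.2 + uq.2) | tp in X & uq in Y].

Definition wdown K (X : set (term K * nat)) : set (term K * nat) :=
  [set (TPos (mkbox tp.1), tp.2) | tp in X].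

(* [cowinterp k rho A] is the interpretation of [mdual A], see [cowinterpE]. *)
Fixpoint winterp K (k : set (cmd K * nat)) (rho : nat -> set (term K * nat))
    (A : mal) : set (term K * nat) :=
  match A with
  | MVar X => rho X
  | MTensor A B => wtensor (winterp k rho A) (winterp k rho B)
  | MDown A => wdown (winterp k rho A)
  | MCoVar X => worth k Pos (rho X)
  | MPar A B => worth k Pos (wtensor (cowinterp k rho A) (cowinterp k rho B))
  | MUp A => worth k Pos (wdown (cowinterp k rho A))
  end
with cowinterp K (k : set (cmd K * nat)) (rho : nat -> set (term K * nat))
    (A : mal) : set (term K * nat) :=
  match A with
  | MVar X => worth k Pos (rho X)
  | MTensor A B => worth k Pos (wtensor (winterp k rho A) (winterp k rho B))
  | MDown A => worth k Pos (wdown (winterp k rho A))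
  | MCoVar X => rho X
  | MPar A B => wtensor (cowinterp k rho A) (cowinterp k rho B)
  | MUp A => wdown (cowinterp k rho A)
  end.

Lemma cowinterpE K k rho (A : mal) :
  @cowinterp K k rho A = winterp k rho (mdual A).
Proof.
suff [] : cowinterp k rho A = winterp k rho (mdual A) /\
          winterp k rho A = cowinterp k rho (mdual A) by [].
by elim: A => //= [A [hA gA] B [hB gB]|A [hA gA]|A [hA gA] B [hB gB]|A [hA gA]];
  rewrite ?hA ?gA ?hB ?gB.
Qed.

Lemma winterp_par K k rho (A B : mal) :
  @winterp K k rho (MPar A B) =
  worth k Pos (winterp k rho (MTensor (mdual A) (mdual B))).
Proof. by rewrite /= !cowinterpE. Qed.

Lemma winterp_up K k rho (A : mal) :
  @winterp K k rho (MUp A) = worth k Pos (winterp k rho (MDown (mdual A))).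
Proof. by rewrite /= !cowinterpE. Qed.

(* Main.v *)
(** Every element of an interpretation is a closed value, since a negative
    formula [C^*] is the dual of a tensor with a positive first component: no
    tuple of non-values is ever formed. On values, [(u, K)] is an actual pair and
    [<t^-|u>{K}] unfolds to [<t^-|(u, K)>], so that the membership condition of
    the forcing orthogonal at [p] is literally that of the weighted orthogonal:
    the quantifiers over [r] and [K] in [C[p + r]] are those of the quantitative
    pole. The equivalence follows by induction on [C], generalized to arbitrary
    arguments of the predicate [C^*] and proved together with its dual. *)
Require Import Defs.
From mathcomp Require Import all_boot boolp classical_sets.

Set Implicit Arguments.
Unset Strict Implicit.
Unset Printing Implicit Defensive.

Local Open Scope classical_set_scope.

Lemma ieval_ilift (v v' : nat -> nat) (T : iterm) :
  (forall i, v' i.+1 = v i) -> ieval v' (ilift T) = ieval v T.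
Proof. by move=> vE; elim: T => //= T -> U ->. Qed.

(** The invariant carried through the induction: on such terms [mkpair] and [mkbox] compute to
    genuine [Pair] and [Box] values. *)
Definition closed_values (K : pol -> Type) : set (term K) :=
  [set t | closed_term t /\ (tpol t = Neg \/ exists V, t = TPos (Val V))].

Lemma closed_values_pos (K : pol -> Type) :
  @closed_pos_values K `<=` @closed_values K.
Proof. by move=> t [ct tV]; split=> //; right. Qed.

Lemma mkpair_closed (K : pol -> Type) (t u : term K) :
  @closed_values K t -> @closed_values K u ->
  @closed_pos_values K (TPos (mkpair t u)).
Proof.
case: t => [[V|c]|V] [ct []] => [//|_|//|[] //|_|[] //];
  case: u => [[V'|c']|V'] [cu []] => [//|_|//|[] //|_|[] //];
  by split; [apply/andP | eexists].
Qed.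

Lemma mkbox_closed (K : pol -> Type) (t : term K) :
  @closed_values K t -> @closed_pos_values K (TPos (mkbox t)).
Proof.
case: t => [[V|c]|V] [ct []] => [//|_|//|[] //|_|[] //];
  by split=> //; eexists.
Qed.

Lemma wtensor_closed (K : pol -> Type) (W W' : set (term K * nat)) :
  (forall tp, W tp -> @closed_values K tp.1) ->
  (forall tp, W' tp -> @closed_values K tp.1) ->
  forall tp, wtensor W W' tp -> @closed_pos_values K tp.1.
Proof.
move=> Wcl W'cl _ [tp Wtp [uq W'uq <-]].
by apply: mkpair_closed; [apply: Wcl | apply: W'cl].
Qed.

Lemma wdown_closed (K : pol -> Type) (W : set (term K * nat)) :
  (forall tp, W tp -> @closed_values K tp.1) ->
  forall tp, wdown W tp -> @closed_pos_values K tp.1.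
Proof. by move=> Wcl _ [tp Wtp <-]; apply/mkbox_closed/Wcl. Qed.

(** The orthogonal of a positive set is negative, and every negative term is a value. *)
Lemma worth_closed (K : pol -> Type) (k : set (cmd K * nat))
    (W : set (term K * nat)) (tp : term K * nat) :
  worth k Pos W tp -> @closed_values K tp.1.
Proof. by case=> ct negt _; split=> //; left. Qed.

(* The values of the iota-variables are arbitrary, because the existential
   quantifiers in the translation of a tensor change them. *)
Definition represents (K : pol -> Type) (k : set (ncmd K)) (rho : valuation K)
    (A : iterm -> form) (W : set (term K * nat)) : Prop :=
  forall (rho' : valuation K) (T : iterm) (t : term K),
    pval rho' = pval rho ->
    interp k rho' (A T) t <-> W (t, ieval (ival rho') T).

Lemma represents_var (K : pol -> Type) (k : set (ncmd K)) (rho : valuation K)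
    (X : nat) :
  represents k rho (fun T => FPos (FVar X T)) (rho_circ rho X).
Proof. by move=> rho' T t /= ->. Qed.

(** The two existential witnesses are the weights of the components; the equational guard says that
    they sum to the index. *)
Lemma represents_tensor (K : pol -> Type) (k : set (ncmd K))
    (rho : valuation K) (A B : iterm -> form) (W W' : set (term K * nat)) :
  represents k rho A W -> represents k rho B W' ->
  represents k rho (fun T => FPos (star_tensor A B T)) (wtensor W W').
Proof.
move=> AW BW' rho' T t rhoE.
have liftE r1 r2 : ieval (ival (vcons r2 (vcons r1 rho'))) (ilift (ilift T)) =
                   ieval (ival rho') T.
  by rewrite (@ieval_ilift (ival (vcons r1 rho'))) // (@ieval_ilift (ival rho')).
split=> /=.
- case=> r1 _ [r2 _]; rewrite liftE.
  (* If the guard fails, the interpretation is [set0] and there is nothing to prove. *)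
  case: eqP => [-> | _ []] [u uA [v vB <-]].
  (* In the extended valuation [IVar 1] denotes [r1] and [IVar 0] denotes [r2]. *)
  exists (u, r1); first exact: (AW (vcons r2 (vcons r1 rho')) (IVar 1) u rhoE).1.
  by exists (v, r2) => //; apply: (BW' (vcons r2 (vcons r1 rho')) (IVar 0) v rhoE).1.
- case=> -[u r1] Wu [[v r2] W'v [<- /= TE]].
  exists r1 => //; exists r2 => //=.
  rewrite liftE -TE eqxx.
  exists u; first exact: (AW (vcons r2 (vcons r1 rho')) (IVar 1) u rhoE).2.
  by exists v => //; apply: (BW' (vcons r2 (vcons r1 rho')) (IVar 0) v rhoE).2.
Qed.

Lemma represents_down (K : pol -> Type) (k : set (ncmd K)) (rho : valuation K)
    (A : iterm -> form) (W : set (term K * nat)) :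
  represents k rho A W ->
  represents k rho (fun T => FPos (star_down A T)) (wdown W).
Proof.
move=> AW rho' T t rhoE; split=> /=.
- by case=> u /(AW _ _ _ rhoE) Wu <-; exists (u, ieval (ival rho') T).
- by case=> -[u r] Wu [<- /= rE]; exists u => //; apply/(AW _ _ _ rhoE); rewrite -rE.
Qed.

Lemma represents_orth (K : pol -> Type) (k : set (ncmd K)) (rho : valuation K)
    (Z : iterm -> pform) (W : set (term K * nat)) :
  (forall tp, W tp -> @closed_pos_values K tp.1) ->
  represents k rho (fun T => FPos (Z T)) W ->
  represents k rho (forcing_orth Z) (worth (pole_circ k) Pos W).
Proof.
move=> Wcl ZW rho' T t rhoE /=.
have liftE r : ieval (ival (vcons r rho')) (ilift T) = ieval (ival rho') T.
  exact: ieval_ilift.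
(* The first tensor component of the dual is [FPos (Z _)], so [fits] reduces to [tpol t = opp Pos]:
   only the orthogonality conditions remain to be compared. *)
split=> -[ct negt tZ]; split=> //.
(* [Wcl] gives the positivity that [worthogonal] inspects and the closedness that [closed_cmd]
   requires. *)
- case=> a r Wa; have [ca [V aE]] := Wcl _ Wa; rewrite /= in ca aE.
  move: Wa ca; rewrite {}aE => Wa ca; case: t ct negt tZ => //= b cb _ tZ.
  split; first by apply/andP.
  move=> s s_ge; apply: tZ; exists r => //; exists (TPos (Val V)).
    exact: (ZW (vcons r rho') (IVar 0) _ rhoE).2.
  (* The weight of the cut is [r + p], while the bound in the constant is [p + r]. *)
  by exists s => //; rewrite liftE addnC.
- move=> u [r _ [a /(ZW (vcons r rho') (IVar 0) _ rhoE) Wa [s s_ge [<-]]]].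
  have [ca [V aE]] := Wcl _ Wa; rewrite /= in ca aE.
  move: (tZ _ Wa); rewrite aE; case: t ct negt tZ => //= b cb _ tZ.
  by rewrite /worthogonal /= => -[_]; apply; rewrite addnC -(liftE r).
Qed.

(** Negative connectives call on the duals of their components, and [represents_orth] needs closed
    positive values, hence the joint induction on four claims. *)
Lemma represents_star (K : pol -> Type) (k : set (ncmd K)) (rho : valuation K)
    (rho_cl : forall X n, pval rho X n `<=` @closed_pos_values K) (C : mal) :
  let k0 := pole_circ k in let rho0 := rho_circ rho in
  [/\ represents k rho (star C) (winterp k0 rho0 C),
      represents k rho (costar C) (cowinterp k0 rho0 C),
      forall tp, winterp k0 rho0 C tp -> @closed_values K tp.1 &
      forall tp, cowinterp k0 rho0 C tp -> @closed_values K tp.1].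
Proof.
have Xcl X tp : rho_circ rho X tp -> @closed_pos_values K tp.1 by apply: rho_cl.
have posW (W : set (term K * nat)) :
    (forall tp, W tp -> @closed_pos_values K tp.1) ->
    forall tp, W tp -> @closed_values K tp.1.
  by move=> Wcl tp /Wcl; apply: closed_values_pos.
move=> k0 rho0.
(* One step serves a positive connective and its dual; the three negative cases only permute its
   conclusions. *)
have dual (Z : iterm -> pform) (W : set (term K * nat)) :
    represents k rho (fun T => FPos (Z T)) W ->
    (forall tp, W tp -> @closed_pos_values K tp.1) ->
  [/\ represents k rho (fun T => FPos (Z T)) W,
      represents k rho (forcing_orth Z) (worth k0 Pos W),
      forall tp, W tp -> @closed_values K tp.1 &
      forall tp, worth k0 Pos W tp -> @closed_values K tp.1].
  move=> ZW Wcl; split=> //; first exact: represents_orth.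
    exact: posW.
  by move=> tp; apply: worth_closed.
elim: C => [X|A [A1 A2 A3 A4] B [B1 B2 B3 B4]|A [A1 A2 A3 A4]
           |X|A [A1 A2 A3 A4] B [B1 B2 B3 B4]|A [A1 A2 A3 A4]] /=.
- exact: dual (@represents_var K k rho X) (Xcl X).
- by apply: dual; [apply: represents_tensor | apply: wtensor_closed].
- by apply: dual; [apply: represents_down | apply: wdown_closed].
- by have [? ? ? ?] := dual _ _ (@represents_var K k rho X) (Xcl X).
- by have [? ? ? ?] := dual _ _ (represents_tensor A2 B2)
    (wtensor_closed A4 B4).
- by have [? ? ? ?] := dual _ _ (represents_down A2) (wdown_closed A4).
Qed.

Theorem lemma89 (K : pol -> Type) (k : set (ncmd K)) (hk : is_pole k)
    (C : mal) (D : set (set (term K))) (hD : is_domain k D)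
    (rho : valuation K) (hrho : total_valuation D rho)
    (t : term K) (ht : closed_term t) (p : nat) :
  interp k rho (star C (INum p)) t <->
  winterp (pole_circ k) (rho_circ rho) C (t, p).
Proof.
(* Totality puts each [pval rho X n] in [D], whose members consist of closed positive values. *)
have rho_cl X n : pval rho X n `<=` @closed_pos_values K.
  exact: domain_values hD _ (hrho X n).
by have [starW _ _ _] := represents_star k rho_cl C; apply: starW.
Qed.
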